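(* Let $\nu \ge 3$ be a fixed integer and let $G \in \{\mathbb{T}, SO(2), O(3)\}$. Then $$\frac{\#\mathcal{D}_{G}(\nu, D)}{\#\mathcal{K}_{G}(\nu, D)} = \Theta\left(\frac{1}{D}\right) \qquad \text{as } D \to \infty .$$
   Context: $D$ ranges over positive integers, $\mathbb{Z}_+=\{0,1,2,\dots\}$, $\#$ denotes cardinality, and $[\cdot]$ denotes a multiset (unordered, with repetitions). A multi-index is a finite multiset $\mathbf{k}=[k^1,\dots,k^\nu]$ of one-particle indices; $\nu=\nu(\mathbf{k})\ge 1$ is its correlation order. The one-particle indices are: $k^t=m^t\in\mathbb{Z}$ if $G=\mathbb{T}$; $k^t=(n^t,m^t)\in\mathbb{Z}_+\times\mathbb{Z}$ if $G=SO(2)$; $k^t=(n^t,l^t,m^t)\in\mathbb{Z}_+\times\mathbb{Z}_+\times\mathbb{Z}$ with $|m^t|\le l^t$ if $G=O(3)$. The set $\mathcal{K}^{\rm inv}_G$ of invariant multi-indices consists of all multisets $\mathbf{k}$ (of any order $\nu\ge1$) of one-particle indices such that $\sum_{t=1}^{\nu} m^t=0$ and, if $G=O(3)$, additionally $\sum_{t=1}^{\nu} l^t$ is even. The total degree is $\|\mathbf{k}\|_1=\sum_t |m^t|$ for $G=\mathbb{T}$, $\|\mathbf{k}\|_1=\sum_t (n^t+|m^t|)$ for $G=SO(2)$, and $\|\mathbf{k}\|_1=\sum_t(n^t+l^t)$ for $G=O(3)$. Set $$\mathcal{K}_G(\nu,D)=\{\mathbf{k}\in\mathcal{K}^{\rm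 inv}_G : \|\mathbf{k}\|_1\le D,\ \nu(\mathbf{k})=\nu\}.$$ An element $\mathbf{k}\in\mathcal{K}^{\rm inv}_G$ is called dependent if there exist $\mathbf{k}_1,\mathbf{k}_2\in\mathcal{K}^{\rm inv}_G$ (each of order at least $1$) such that $\mathbf{k}$ is the multiset union (multiplicities added) of $\mathbf{k}_1$ and $\mathbf{k}_2$; otherwise it is independent. $\mathcal{D}_G(\nu,D)$ is the set of dependent elements of $\mathcal{K}_G(\nu,D)$. *)

(* Defs.v *)
From mathcomp Require Import all_boot all_order all_algebra.
From mathcomp Require Import finmap multiset.
From mathcomp Require Import all_classical all_reals all_analysis.
From mathcomp Require Import zify.

Set Implicit Arguments.
Unset Strict Implicit.
Unset Printing Implicit Defensive.

Import Order.TTheory GRing.Theory Num.Theory.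

Local Open Scope mset_scope.
Local Open Scope classical_set_scope.
Local Open Scope nat_scope.

(* Labels for the circle group, SO(2) and O(3): the groups enter only through
   the index sets, degrees and invariance conditions attached to them. *)
Variant sym_group := Torus | SO2 | O3.

(* m for the torus, (n, m) for SO(2), (n, l, m) with |m| <= l for O(3) *)
Definition particle_index (G : sym_group) : choiceType :=
  match G with
  | Torus => int
  | SO2 => (nat * int)%type
  | O3 => {x : nat * nat * int | absz x.2 <= x.1.2}
  end.

Definition idx_m (G : sym_group) : particle_index G -> int :=
  match G return particle_index G -> int with
  | Torus => fun m => m
  | SO2 => fun x => x.2
  | O3 => fun x => (val x).2
  end.

(* The contribution of a one-particle index to the quantity that must be even:
   l for O(3), and 0 for the groups carrying no parity condition. *)
Definition idx_parity (G : sym_group) : particle_index G -> nat :=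
  match G return particle_index G -> nat with
  | Torus => fun=> 0
  | SO2 => fun=> 0
  | O3 => fun x => (val x).1.2
  end.

Definition idx_degree (G : sym_group) : particle_index G -> nat :=
  match G return particle_index G -> nat with
  | Torus => fun m : int => absz m
  | SO2 => fun x => x.1 + absz x.2
  | O3 => fun x => (val x).1.1 + (val x).1.2
  end.

(* Multisets coerce to sequences listing each element with its multiplicity, so
   [size] and [\sum_(i <- k)] below count multiplicities. *)
Definition corr_order (G : sym_group) (k : {mset particle_index G}) : nat := size k.

Definition total_degree (G : sym_group) (k : {mset particle_index G}) : nat :=
  \sum_(i <- k) idx_degree i.

Definition is_invariant (G : sym_group) (k : {mset particle_index G}) : Prop :=
  [/\ 1 <= corr_order k,
      (\sum_(i <- k) idx_m i = 0)%R &
      ~~ odd (\sum_(i <- k) idx_parity i)].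

Definition is_dependent (G : sym_group) (k : {mset particle_index G}) : Prop :=
  exists k1 k2 : {mset particle_index G},
    [/\ is_invariant k1, is_invariant k2 & k = (k1 `+` k2)%mset].

Definition Kset (G : sym_group) (nu D : nat) : set {mset particle_index G} :=
  [set k | [/\ is_invariant k, total_degree k <= D & corr_order k = nu]].

Definition Dset (G : sym_group) (nu D : nat) : set {mset particle_index G} :=
  [set k | Kset nu D k /\ is_dependent k].

(* [fset_set] is the empty set on infinite sets; [Kset_finite] and [Dset_finite]
   below show that this default value is never used. *)
Definition cardK (G : sym_group) (nu D : nat) : nat :=
  #|` fset_set (@Kset G nu D)|.

Definition cardD (G : sym_group) (nu D : nat) : nat :=
  #|` fset_set (@Dset G nu D)|.

Lemma idx_degree_finite (G : sym_group) (D : nat) :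
  finite_set [set i : particle_index G | idx_degree i <= D].
Proof.
have finZ : finite_set [set m : int | absz m <= D].
  apply: (@sub_finite_set _ _
    ((Posz @` `I_D.+1) `|` ((fun n => - Posz n)%R @` `I_D.+1))).
    case=> n /= nD; first by left; exists n.
    by right; exists n.+1 => //; rewrite NegzE.
  by rewrite finite_setU; split; apply: finite_image; exact: finite_II.
case: G => //=.
- apply: (@sub_finite_set _ _ (`I_D.+1 `*` [set m : int | absz m <= D])).
    by case=> n m /= nmD; split => /=; lia.
  by apply: finite_setX => //; exact: finite_II.
- apply: (@sub_finite_set _ _ ((fun x => insubd
    (exist _ (0, 0, 0%R) (leqnn 0) : {x : nat * nat * int | absz x.2 <= x.1.2})
     x) @` (`I_D.+1 `*` `I_D.+1 `*` [set m : int | absz m <= D]))).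
    move=> x xD; exists (val x); last exact: valKd.
    by have := valP x; move: xD => /=; split => /=; [split => /=|]; lia.
  apply: finite_image; apply: finite_setX => //.
  by apply: finite_setX; exact: finite_II.
Qed.

Lemma Kset_finite (G : sym_group) (nu D : nat) : finite_set (@Kset G nu D).
Proof.
pose X := fset_set [set i : particle_index G | idx_degree i <= D].
apply: (@sub_finite_set _ _
  ((fun t : nu.-tuple X => seq_mset (map val t)) @` setT)); last first.
  by apply: finite_image; exact: finite_finset.
move=> k [_ kD ksz].
have kX i : i \in enum_mset k -> i \in X.
  move=> ik; rewrite in_fset_set; last exact: idx_degree_finite.
  rewrite inE /=; apply: leq_trans kD.
  by rewrite /total_degree (big_rem i) //= leq_addr.
have szk : size (pmap insub (enum_mset k) : seq X) == nu.
  rewrite size_pmap_sub -ksz /corr_order; apply/eqP/eqP; rewrite -all_count.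
  by apply/allP => i /kX.
exists (Tuple szk) => //=.
by rewrite pmap_filter; [rewrite (all_filterP _) ?seq_mset_id//;
  apply/allP => i /kX iX; rewrite insubT|exact: insubK].
Qed.

Lemma Dset_finite (G : sym_group) (nu D : nat) : finite_set (@Dset G nu D).
Proof. by apply: sub_finite_set (@Kset_finite G nu D) => k []. Qed.

(* Main.v *)
(* Let d = 1, 2, 3 be the number of integer coordinates of a one-particle index
   for T, SO(2), O(3), and N = d nu.  The condition sum m = 0 removes one of the
   N degrees of freedom, so #K is of order D^(N-1); a decomposition k = k1 + k2
   imposes it on k1 and on k2 separately, so #D is of order D^(N-2), the sum of
   the exponents d a - 1 and d (nu - a) - 1 for any splitting nu = a + (nu - a).

   The cardinalities are bounded by induction on the order, counting in two ways
   the pairs (i, k) with i an element of k: each k of order a lies in between 1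
   and a such pairs, and for fixed i the map k |-> k - i leads to multisets of
   order a - 1 whose m sum to a prescribed value.  The parity condition is
   dropped in the upper bounds; in the lower bounds all l are taken even.  The
   lower bound for #D uses the multisets containing a particle with m = 0. *)

Require Import Defs.
From mathcomp Require Import all_boot all_order all_algebra.
From mathcomp Require Import finmap multiset.
From mathcomp Require Import all_classical all_reals all_analysis.
From mathcomp Require Import zify.

Set Implicit Arguments.
Unset Strict Implicit.
Unset Printing Implicit Defensive.

Import Order.TTheory GRing.Theory Num.Theory.
Import numFieldNormedType.Exports.

Local Open Scope ring_scope.
Local Open Scope classical_set_scope.

(** * Cardinality of finite sets: injections, covers and indicator sums *)

Section FiniteSetCardinality.
Local Open Scope nat_scope.

Lemma card_fset_set_sub (T : choiceType) (A B : set T) :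
  finite_set B -> A `<=` B -> #|` fset_set A| <= #|` fset_set B|.
Proof.
move=> finB AB; apply: fsubset_leq_card.
by rewrite -fset_set_sub//; exact: sub_finite_set finB.
Qed.

Lemma card_fset_set_inj (T U : choiceType) (f : T -> U) (A : set T)
    (B : set U) :
  finite_set A -> finite_set B -> set_inj A f -> f @` A `<=` B ->
  #|` fset_set A| <= #|` fset_set B|.
Proof.
move=> finA finB injf fAB.
apply: leq_trans (card_fset_set_sub finB fAB).
rewrite fset_set_image// card_in_imfset//= => x y.
by rewrite !in_fset_set//; exact: injf.
Qed.

Lemma card_fset_set_le_seq (T : choiceType) (A : set T) (s : seq T) :
  finite_set A -> (forall x, A x -> x \in s) -> #|` fset_set A| <= size s.
Proof.
move=> finA As; apply: uniq_leq_size (fset_uniq _) _ => x.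
by rewrite in_fset_set// inE; exact: As.
Qed.

Lemma card_fset_set_ge (F : finType) (T : choiceType) (f : F -> T)
    (B : set T) :
  finite_set B -> injective f -> (forall x, B (f x)) ->
  #|F| <= #|` fset_set B|.
Proof.
move=> finB injf fB; rewrite cardE -(size_map f).
apply: uniq_leq_size; first by rewrite map_inj_uniq// enum_uniq.
by move=> _ /mapP[x _ ->]; rewrite in_fset_set// inE.
Qed.

Lemma card_fset_set_le (F : finType) (T : choiceType) (f : T -> F)
    (A : set T) :
  finite_set A -> set_inj A f -> #|` fset_set A| <= #|F|.
Proof.
move=> finA injf; rewrite cardE -(size_map f).
apply: uniq_leq_size => [|x _]; last exact: mem_enum.
rewrite map_inj_in_uniq ?fset_uniq// => x y.
by rewrite !in_fset_set//; exact: injf.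
Qed.

Lemma card_fset_set_image2 (T U V : choiceType) (f : T -> U -> V)
    (A : set T) (B : set U) (S : set V) :
  finite_set A -> finite_set B -> finite_set S ->
  (forall z, S z -> exists x y, [/\ A x, B y & z = f x y]) ->
  #|` fset_set S| <= #|` fset_set A| * #|` fset_set B|.
Proof.
move=> finA finB finS Sf.
rewrite -(size_allpairs f); apply: card_fset_set_le_seq => // z.
move=> /Sf[x [y [Ax By ->]]]; apply: allpairs_f.
  by rewrite in_fset_set// inE.
by rewrite in_fset_set// inE.
Qed.

(** Union bound by induction on [n]: the part of [S] in [A n] is split off, and the bounds on the
    other pieces pass to what remains. *)
Lemma card_fset_set_cover (T : choiceType) (S : set T) (A : nat -> set T)
    (n c : nat) :
  finite_set S ->
  (forall i, i < n -> #|` fset_set (S `&` A i)| <= c) ->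
  (forall x, S x -> exists2 i, i < n & A i x) ->
  #|` fset_set S| <= n * c.
Proof.
elim: n S => [|n IHn] S finS Ac SA.
  rewrite leqn0 cardfs_eq0; apply/eqP/fsetP => x.
  by rewrite in_fset_set// inE; apply/negP; rewrite inE => /SA[].
have -> : S = (S `\` A n) `|` (S `&` A n) by rewrite setUC setUIDK.
rewrite fset_setU; [|exact: finite_setD|exact: finite_setIl].
rewrite cardfsU mulSn addnC; apply: leq_trans (leq_subr _ _) _.
rewrite leq_add ?Ac//; apply: IHn; first exact: finite_setD.
  move=> i lt_in; apply: leq_trans (Ac i (ltnW lt_in)).
  apply: card_fset_set_sub; first exact: finite_setIl.
  by move=> x [[]].
move=> x [/SA[i]]; rewrite ltnS leq_eqVlt => /orP[/eqP->//|lt_in Ai _].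
by exists i.
Qed.

Lemma card_fset_set_count (T : choiceType) (A : set T) (P : pred T) :
  finite_set A ->
  #|` fset_set (A `&` [set x | P x])| = \sum_(x <- fset_set A) P x.
Proof.
move=> finA.
have -> : fset_set (A `&` [set x | P x]) = [fset x in fset_set A | P x]%fset.
  apply/fsetP => x; rewrite in_fset_set; last exact: finite_setIl.
  rewrite !inE/= in_fset_set//.
  by apply/idP/andP; rewrite !inE.
by rewrite card_fset_sum1 big_fset/= big_mkcond; apply: eq_bigr => x _; case: P.
Qed.

Lemma sum_fset_set_le (T : choiceType) (A : set T) (f : T -> nat) (c : nat) :
  finite_set A -> (forall x, A x -> f x <= c) ->
  \sum_(x <- fset_set A) f x <= #|` fset_set A| * c.
Proof.
move=> finA fc; rewrite card_fset_sum1 big_distrl/= !big_seq.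
by apply: leq_sum => x; rewrite in_fset_set// inE mul1n; exact: fc.
Qed.

Lemma sum_fset_set_ge (T : choiceType) (A : set T) (f : T -> nat) (c : nat) :
  finite_set A -> (forall x, A x -> c <= f x) ->
  #|` fset_set A| * c <= \sum_(x <- fset_set A) f x.
Proof.
move=> finA fc; rewrite card_fset_sum1 big_distrl/= !big_seq.
by apply: leq_sum => x; rewrite in_fset_set// inE mul1n; exact: fc.
Qed.

End FiniteSetCardinality.

(** * Multisets and double counting of incidences *)

Section Multisets.
Local Open Scope nat_scope.
Local Open Scope mset_scope.
Variable I : choiceType.
Implicit Types (i : I) (k : {mset I}).

(** Enumerations of multisets are compared only up to permutation, which is enough for [size], [all]
    and commutative big operators. *)
Lemma perm_msetD k1 k2 : perm_eq (k1 `+` k2) (k1 ++ k2).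
Proof.
apply/eq_seq_msetP; rewrite seq_mset_id; apply/msetP => x.
by rewrite msetE2 mset_seqE count_cat !count_mem_mset.
Qed.

Lemma perm_mset1D i k : perm_eq (i +` k) (i :: k).
Proof. by have := perm_msetD [mset i] k; rewrite enum_msetn. Qed.

Lemma size1_mset k : size k = 1 -> exists i, k = [mset i].
Proof.
case: (mset_0Vmem k) => [->|[i ik]]; first by rewrite size_mset0.
rewrite -(msetB1K ik) (perm_size (perm_mset1D _ _)) /= => -[/eqP].
by rewrite size_mset_eq0 => /eqP ->; exists i; rewrite msetD0.
Qed.

Lemma finite_mset_size (B : set I) (a : nat) :
  finite_set B ->
  finite_set [set k : {mset I} | size k = a /\ forall i, i \in k -> B i].
Proof.
move=> finB; elim: a => [|a IHa].
  apply: (@sub_finite_set _ _ [set (mset0 : {mset I})]) => // k [/eqP].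
  by rewrite size_mset_eq0 => /eqP.
apply: (@sub_finite_set _ _ ((fun x => x.1 +` x.2) @`
    (B `*` [set k : {mset I} | size k = a /\ forall i, i \in k -> B i])));
    last first.
  by apply: finite_image; exact: finite_setX.
move=> k /= [].
case: (mset_0Vmem k) => [->|[i ik]]; first by rewrite size_mset0.
rewrite -{1}(msetB1K ik) (perm_size (perm_mset1D _ _)) /= => -[sk kB].
exists (i, k `\ i) => /=; last exact: msetB1K.
split; [exact: kB|split=> //= j jk; apply: kB].
by move: jk; rewrite in_msetB1 => /andP[].
Qed.

Lemma sum_card_incidence (B : set I) (T : set {mset I}) :
  finite_set B -> finite_set T ->
  \sum_(i <- fset_set B) #|` fset_set (T `&` [set k : {mset I} | i \in k])| =
  \sum_(k <- fset_set T) #|` fset_set (B `&` [set i | i \in (k : {mset I})])|.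
Proof.
move=> finB finT.
under eq_bigr do rewrite card_fset_set_count//.
by rewrite exchange_big; under [RHS]eq_bigr do rewrite card_fset_set_count//.
Qed.

(** A multiset of size at most [s] has at most [s] distinct elements, hence lies in at most [s]
    pairs. The factor [r] carries a denominator, so that no division in [nat] occurs. *)
Lemma leq_card_incidence (B : set I) (T : set {mset I}) (c r s : nat) :
  finite_set B -> finite_set T ->
  (forall i, B i ->
    c <= #|` fset_set (T `&` [set k : {mset I} | i \in k])| * r) ->
  (forall k, T k -> size k <= s) ->
  #|` fset_set B| * c <= #|` fset_set T| * s * r.
Proof.
move=> finB finT Bc Ts.
apply: leq_trans (sum_fset_set_ge finB Bc) _.
rewrite -big_distrl leq_mul2r/= sum_card_incidence//; apply/orP; right.
apply: sum_fset_set_le => // k /Ts.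
apply: leq_trans; apply: card_fset_set_le_seq; first exact: finite_setIl.
by move=> i [].
Qed.

(** Every [k] of [T] lies in at least one incident pair, so [T] is no larger than the set of
    pairs. *)
Lemma geq_card_incidence (B : set I) (T : set {mset I}) (c : nat) :
  finite_set B -> finite_set T ->
  (forall i, B i -> #|` fset_set (T `&` [set k : {mset I} | i \in k])| <= c) ->
  (forall k, T k -> exists2 i, B i & i \in k) ->
  #|` fset_set T| <= #|` fset_set B| * c.
Proof.
move=> finB finT Bc TB; rewrite -[leqLHS]muln1.
apply: leq_trans (sum_fset_set_le finB Bc).
rewrite sum_card_incidence//; apply: sum_fset_set_ge => // k /TB[i Bi ik].
rewrite cardfs_gt0; apply/fset0Pn; exists i.
by rewrite in_fset_set ?inE//; exact: finite_setIl.
Qed.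

End Multisets.

(** * Counting one-particle indices, with m free or prescribed *)

Section OneParticle.
Local Open Scope nat_scope.

Definition index_dim (G : sym_group) : nat :=
  match G with Torus => 1 | SO2 => 2 | O3 => 3 end.

(** Parity imposed on each particle, rather than on the sum, is inherited by every sub-multiset. It
    always holds for T and SO(2). *)
Definition even_index (G : sym_group) (i : particle_index G) : bool :=
  ~~ odd (idx_parity i).

Definition O3_index (n l : nat) (m : int) (lm : absz m <= l) :
    particle_index O3 :=
  exist (fun x : nat * nat * int => absz x.2 <= x.1.2) (n, l, m) lm.

Definition ball (G : sym_group) (P : pred (particle_index G)) (D : nat) :
    set (particle_index G) :=
  [set i | P i /\ idx_degree i <= D].

Definition slice (G : sym_group) (P : pred (particle_index G)) (c : int)
    (D : nat) : set (particle_index G) :=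
  ball P D `&` [set i | idx_m i = c].

Lemma finite_ball (G : sym_group) (P : pred (particle_index G)) (D : nat) :
  finite_set (ball P D).
Proof. by apply: sub_finite_set (idx_degree_finite G D) => i []. Qed.

Lemma finite_slice (G : sym_group) (P : pred (particle_index G)) (c : int)
    (D : nat) :
  finite_set (slice P c D).
Proof. exact: finite_setIl (finite_ball P D). Qed.

Lemma absz_idx_m (G : sym_group) (i : particle_index G) :
  absz (idx_m i) <= idx_degree i.
Proof. by case: G i => [|[n m]|[[[n l] m]]] //= *; lia. Qed.

Lemma inord_inj (D x y : nat) : x <= D -> y <= D ->
  inord x = inord y :> 'I_D.+1 -> x = y.
Proof. by move=> xD yD /(congr1 val); rewrite !val_insubd !ltnS xD yD. Qed.

(** The shift by [D] sends the interval from -D to D into the naturals up to 2D, where neither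
    [absz] nor [inord] loses information. *)
Lemma inord_shift_inj (D : nat) (x y : int) : absz x <= D -> absz y <= D ->
  inord (absz (x + Posz D)%R) = inord (absz (y + Posz D)%R) :> 'I_(2 * D).+2 ->
  x = y.
Proof. by move=> xD yD /inord_inj; lia. Qed.

Lemma inord_pair_inj (D x y : nat) (a b : int) :
  x + absz a <= D -> y + absz b <= D -> inord x = inord y :> 'I_(2 * D).+2 ->
  inord (absz (a + Posz D)%R) = inord (absz (b + Posz D)%R) :> 'I_(2 * D).+2 ->
  (x, a) = (y, b).
Proof. 
move=> xD yD exy eab; have -> : x = y by apply: inord_inj exy; lia.
by have -> : a = b by apply: inord_shift_inj eab; lia. Qed.

(** Each coordinate is bounded by [D] in absolute value (for O(3), |m| <= l <= D), so it embeds into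
    an ordinal type with 2D + 2 elements. *)
Lemma card_ball_le (G : sym_group) (P : pred (particle_index G)) (D : nat) :
  #|` fset_set (ball P D)| <= (2 * D.+1) ^ index_dim G.
Proof.
have finB := finite_ball P D; rewrite (_ : 2 * D.+1 = (2 * D).+2); last by lia.
pose r (x : nat) : 'I_(2 * D).+2 := inord x.
pose s (x : int) := r (absz (x + Posz D)%R).
case: G P finB => P finB /=.
- rewrite expn1 -[leqRHS]card_ord.
  apply: (@card_fset_set_le _ _ s) => // x y; rewrite !inE => -[_ xD] [_ yD].
  exact: inord_shift_inj.
- rewrite -mulnn -[X in X * X]card_ord -card_prod.
  apply: (@card_fset_set_le _ _ (fun i => (r i.1, s i.2))) => // -[n m] [n' m'].
  rewrite !inE => -[_ /= nmD] [_ /= nmD'] [].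
  exact: inord_pair_inj.
- rewrite (expnSr _ 2) -mulnn -[in leqRHS](card_ord (2 * D).+2) -!card_prod.
  apply: (@card_fset_set_le _ _
    (fun i => (r (val i).1.1, r (val i).1.2, s (val i).2))) => //.
  move=> [[[n l] m] lm] [[[n' l'] m'] lm']; rewrite !inE.
  move=> -[_ /= nlD] [_ /= nlD'] [e1 e2 e3]; apply: val_inj => /=.
  move: lm lm' nlD nlD' e1 e2 e3 => /= lm lm' nlD nlD'.
  move=> en el em; have nn : n = n' by apply: inord_inj en; lia.
  have ll : l = l' by apply: inord_inj el; lia.
  have mm : m = m' by apply: inord_shift_inj em; lia.
  by rewrite nn ll mm.
Qed.

Lemma card_slice_le (G : sym_group) (P : pred (particle_index G)) (c : int)
    (D : nat) :
  #|` fset_set (slice P c D)| <= (2 * D.+1) ^ (index_dim G).-1.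
Proof.
have finB := finite_slice P c D.
rewrite (_ : 2 * D.+1 = (2 * D).+2); last by lia.
pose r (x : nat) : 'I_(2 * D).+2 := inord x.
case: G P finB => P finB /=.
- rewrite expn0 -[leqRHS]card_unit.
  apply: (@card_fset_set_le _ _ (fun=> tt)) => // x y.
  by rewrite !inE => -[_ /= ->] [_ /= ->].
- rewrite expn1 -[leqRHS]card_ord.
  apply: (@card_fset_set_le _ _ (fun i => r i.1)) => // -[n m] [n' m'].
  rewrite !inE => -[[_ /= nmD] /= ->] [[_ /= nmD'] /= ->].
  by move=> /inord_inj->//; lia.
- rewrite -mulnn -[X in X * X]card_ord -card_prod.
  apply: (@card_fset_set_le _ _
    (fun i => (r (val i).1.1, r (val i).1.2))) => //.
  move=> [[[n l] m] lm] [[[n' l'] m'] lm']; rewrite !inE.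
  move=> -[[_ /= nlD] /= mc] [[_ /= nlD'] /= mc'] [e1 e2]; apply: val_inj => /=.
  have nn : n = n' by apply: inord_inj e1; lia.
  have ll : l = l' by apply: inord_inj e2; lia.
  by rewrite nn ll mc mc'.
Qed.

(** The radius comes from O(3). For x, y, z < E take n = x, l = 2(E + y), m = z: then l is even and
    exceeds m, and n + l stays below 5E. *)
Lemma card_ball_ge (G : sym_group) (E : nat) :
  E ^ index_dim G <= #|` fset_set (ball (@even_index G) (5 * E))|.
Proof.
have finB := finite_ball (@even_index G) (5 * E); case: G finB => finB /=.
- rewrite expn1 -[leqLHS]card_ord.
  apply: (@card_fset_set_ge _ _ (fun n : 'I_E => Posz n)) => //.
    by move=> x y [] /val_inj.
  by move=> x; have := ltn_ord x; split => //=; lia.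
- rewrite -mulnn -[X in X * X]card_ord -card_prod.
  apply: (@card_fset_set_ge _ _
    (fun x : 'I_E * 'I_E => (nat_of_ord x.1, Posz x.2))) => //.
    by move=> [x1 x2] [y1 y2] [] /val_inj-> /val_inj->.
  by move=> [[x ?] [y ?]]; split => //=; lia.
- rewrite (expnSr _ 2) -mulnn -[in leqLHS](card_ord E) -!card_prod.
  have lm (x : 'I_E * 'I_E * 'I_E) : absz (Posz x.2) <= 2 * (E + x.1.2).
    by have := ltn_ord x.2; lia.
  apply: (@card_fset_set_ge _ _
    (fun x : 'I_E * 'I_E * 'I_E => O3_index x.1.1 (lm x))) => //.
    move=> [[x1 x2] x3] [[y1 y2] y3] /(congr1 val) /= [].
    move=> /val_inj-> e /val_inj->.
    by congr (_, _, _); apply: val_inj => /=; lia.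
  move=> [[[x ?] [y ?]] [z ?]]; split => /=; last by lia.
  by rewrite /even_index /= oddM.
Qed.

(** For O(3), take n = x, l = 2(|c| + y), m = c with x, y < E: then l is even, |c| <= l, and the
    degree is at most 2ME + 3E. *)
Lemma card_slice_ge (G : sym_group) (c : int) (M E : nat) :
  absz c <= M * E ->
  E ^ (index_dim G).-1 <=
    #|` fset_set (slice (@even_index G) c ((2 * M + 3) * E))|.
Proof.
have finB := finite_slice (@even_index G) c (2 * (M * E) + 3 * E).
move=> cME; rewrite mulnDl -mulnA; case: G finB => finB /=.
- rewrite expn0 -[leqLHS]card_unit.
  apply: (@card_fset_set_ge _ _ (fun=> c)) => //; first by case=> -[].
  by move=> _; do 2?split => //=; lia.
- rewrite expn1 -[leqLHS]card_ord.
  apply: (@card_fset_set_ge _ _ (fun n : 'I_E => (nat_of_ord n, c))) => //.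
    by move=> x y [] /val_inj.
  by move=> [x ?]; do 2?split => //=; lia.
- rewrite -mulnn -[X in X * X]card_ord -card_prod.
  have lm (x : 'I_E * 'I_E) : absz c <= 2 * (absz c + x.2) by lia.
  apply: (@card_fset_set_ge _ _
    (fun x : 'I_E * 'I_E => O3_index x.1 (lm x))) => //.
    move=> [x1 x2] [y1 y2] /(congr1 val) /= [] /val_inj-> e.
    by congr (_, _); apply: val_inj => /=; lia.
  move=> [[x ?] [y ?]]; do 2?split => //=; last by lia.
  by rewrite /even_index /= oddM.
Qed.

End OneParticle.

(** * Counting multisets of given order and given sum of m *)

Section Sectors.
Local Open Scope nat_scope.
Local Open Scope mset_scope.
Variable G : sym_group.
Implicit Types (P : pred (particle_index G)) (i : particle_index G).
Implicit Types (k : {mset particle_index G}) (c : int) (a D : nat).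

(** The target [c] is arbitrary because removing a particle from a multiset of sum zero changes the
    sum. [P] is [predT] in the upper bounds and [even_index] in the lower ones. *)
Definition sector P a c D : set {mset particle_index G} :=
  [set k : {mset particle_index G} |
    [/\ all P k, size k = a, (\sum_(i <- k) idx_m i)%R = c &
        total_degree k <= D]].

Lemma total_degree_msetD k1 k2 :
  total_degree (k1 `+` k2) = total_degree k1 + total_degree k2.
Proof. by rewrite /total_degree (perm_big _ (perm_msetD _ _)) big_cat. Qed.

Lemma total_degree1 i : total_degree [mset i] = idx_degree i.
Proof. by rewrite /total_degree enum_msetn big_seq1. Qed.

Lemma sector_mset1 P i c D : sector P 1 c D [mset i] <-> slice P c D i.
Proof.
rewrite /sector /= total_degree1 enum_msetn /= big_seq1 andbT.
by split=> [[]|[[]]].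
Qed.

Lemma sector_mset1D P a i k c D :
  sector P a (c - idx_m i)%R D k -> P i ->
  sector P a.+1 c (D + idx_degree i) (i +` k).
Proof.
move=> [Pk sk mk dk] Pi; split.
- by rewrite (perm_all _ (perm_mset1D _ _)) /= Pi.
- by rewrite (perm_size (perm_mset1D _ _)) /= sk.
- by rewrite (perm_big _ (perm_mset1D _ _)) big_cons mk /= addrC subrK.
- by rewrite total_degree_msetD total_degree1 addnC leq_add2r.
Qed.

Lemma sector_msetB1 P a i k c D :
  sector P a.+1 c D k -> i \in k -> sector P a (c - idx_m i)%R D (k `\ i).
Proof.
move=> [Pk sk mk dk] ik; move: Pk sk mk dk; rewrite -{1 2 3 4}(msetB1K ik).
rewrite (perm_all _ (perm_mset1D _ _)) (perm_size (perm_mset1D _ _)) /=.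
rewrite (perm_big _ (perm_mset1D _ _)) big_cons total_degree_msetD.
move=> /andP[_ Pk] [sk] <- dk; split => //; first by rewrite addrC addKr.
exact: leq_trans (leq_addl _ _) dk.
Qed.

Lemma mem_sector_ball P a c D k i : sector P a c D k -> i \in k -> ball P D i.
Proof.
move=> [/allP Pk _ _ dk] ik; split; first exact: Pk.
by apply: leq_trans dk; rewrite -(msetB1K ik) total_degree_msetD total_degree1
  leq_addr.
Qed.

Lemma finite_sector P a c D : finite_set (sector P a c D).
Proof.
apply: sub_finite_set (finite_mset_size a (finite_ball P D)) => k kS.
by case: (kS) => _ sk _ _; split => // i; exact: mem_sector_ball kS.
Qed.

Lemma sector_sub P a c D D' : D <= D' ->
  (sector P a c D `<=` sector P a c D')%classic.
Proof. by move=> DD' k [Pk sk mk dk]; split => //; exact: leq_trans DD'. Qed.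

(** The bound is uniform in [c], so the induction applies to the target c - m(i) left after removing
    i. Each step multiplies by the size of the ball, adding d to the exponent; the base case is a
    slice. *)
Lemma card_sector_le P a c D :
  #|` fset_set (sector P a.+1 c D)| <= (2 * D.+1) ^ (index_dim G * a.+1).-1.
Proof.
elim: a c => [|a IHa] c.
  rewrite muln1; apply: leq_trans (card_slice_le P c D).
  rewrite -(size_map (fun i => [mset i])).
  apply: card_fset_set_le_seq => [|k kS]; first exact: finite_sector.
  case: (kS) => _ /size1_mset[i ki] _ _; rewrite ki map_f//.
  rewrite in_fset_set; last exact: finite_slice.
  by rewrite inE; apply/sector_mset1; rewrite -ki.
apply: leq_trans (geq_card_incidence (finite_ball P D) (finite_sector _ _ _ _)
  (c := (2 * D.+1) ^ (index_dim G * a.+1).-1) _ _) _.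
- move=> i Bi; apply: leq_trans (IHa (c - idx_m i)%R).
  apply: (@card_fset_set_inj _ _ (fun k => k `\ i)).
  + exact/finite_setIl/finite_sector.
  + exact: finite_sector.
  + move=> k k'; rewrite !inE => -[_ /= ik] [_ /= ik'] e.
    by rewrite -(msetB1K ik) e msetB1K.
  + by move=> _ [k [kS ik]] <-; exact: sector_msetB1.
- move=> k kS; case: (mset_0Vmem k) => [k0|[i ik]].
    by case: kS => _; rewrite k0 size_mset0.
  by exists i => //; exact: mem_sector_ball kS ik.
- apply: (@leq_trans ((2 * D.+1) ^ index_dim G *
    (2 * D.+1) ^ (index_dim G * a.+1).-1)).
    by rewrite leq_mul2r card_ball_le orbT.
  by rewrite -expnD; apply/eq_leq; congr (_ ^ _); case: (G) => /=; lia.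
Qed.

(** For fixed i the map k |-> i + k is injective, and a multiset of order a + 1 arises from at most
    a + 1 choices of i. [A] will be a ball when counting all multisets, and the slice m = 0 when
    counting dependent ones; [r] accumulates into a factorial. *)
Lemma card_sector_step P (A : set (particle_index G)) a c D D' n r :
  finite_set A -> (forall i, A i -> P i /\ idx_degree i <= D') ->
  (forall i, A i -> n <= #|` fset_set (sector P a (c - idx_m i)%R D)| * r) ->
  #|` fset_set A| * n <=
    #|` fset_set (sector P a.+1 c (D + D') `&`
          [set k | exists2 i, A i & i \in (k : {mset particle_index G})])| *
    a.+1 * r.
Proof.
move=> finA AP An; apply: leq_card_incidence => //.
- exact/finite_setIl/finite_sector.
- move=> i Ai; apply: leq_trans (An i Ai) _; rewrite leq_mul2r.
  apply/orP; right.
  apply: (@card_fset_set_inj _ _ (fun k => i +` k)).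
  + exact: finite_sector.
  + exact/finite_setIl/finite_setIl/finite_sector.
  + by move=> k k' _ _ /(congr1 (fun k => k `\ i)); rewrite !msetD1K.
  + move=> _ [k kS] <-; case: (AP _ Ai) => Pi iD'.
    split; last by rewrite /= mset1D1.
    split; last by exists i => //; rewrite mset1D1.
    by apply: sector_sub (sector_mset1D kS Pi); rewrite leq_add2l.
- by move=> k [[_ -> _ _]].
Qed.

(* Adding the particle i changes the target sum from c to c - m(i), so the
   induction needs the bound for every c up to a multiple of E. *)
Lemma card_sector_ge a M : exists L, forall E c, absz c <= M * E ->
  E ^ (index_dim G * a.+1).-1 <=
    #|` fset_set (sector (@even_index G) a.+1 c (L * E))| * a.+1`!.
Proof.
elim: a M => [|a IHa] M.
  exists (2 * M + 3) => E c cME; rewrite factS fact0 !muln1.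
  apply: leq_trans (card_slice_ge G cME) _.
  apply: (@card_fset_set_inj _ _ (fun i => [mset i])).
  - exact: finite_slice.
  - exact: finite_sector.
  - by move=> i j _ _; exact: (@msetn_inj _ 1).
  - by move=> _ [i iS] <-; exact/sector_mset1.
(* The added particle has degree at most 5E, hence |m(i)| <= 5E: both the target and the total
   degree grow by at most 5E. *)
have [L IHL] := IHa (M + 5); exists (L + 5) => E c cME.
have stepE := @card_sector_step (@even_index G) (ball (@even_index G) (5 * E))
  a.+1 c (L * E) (5 * E) (E ^ (index_dim G * a.+1).-1) a.+1`!
  (finite_ball _ _) _ _.
apply: (@leq_trans (E ^ index_dim G * E ^ (index_dim G * a.+1).-1)).
  by rewrite -expnD; apply/eq_leq; congr (_ ^ _); case: (G) => /=; lia.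
apply: leq_trans (leq_mul (card_ball_ge G E) (leqnn _)) _.
apply: leq_trans (stepE _ _) _ => // [i [_ iE]|].
  by apply: IHL; have := absz_idx_m i; lia.
rewrite -mulnA -factS leq_mul2r -mulnDl; apply/orP; right.
by apply: card_fset_set_sub; [exact: finite_sector|move=> k []].
Qed.

End Sectors.

(** * Two-sided bounds for invariant and dependent multi-indices *)

Section DependentCount.
Local Open Scope nat_scope.
Local Open Scope mset_scope.
Variable G : sym_group.
Implicit Types (k : {mset particle_index G}) (n D : nat).

Lemma even_parity_sum k :
  all (@even_index G) k -> ~~ odd (\sum_(i <- k) idx_parity i).
Proof.
move=> /allP kP; rewrite big_seq; elim/big_ind: _ => // x y.
by rewrite oddD => /negbTE-> /negbTE->.
Qed.

Lemma even_sector_invariant n D k :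
  sector (@even_index G) n.+1 0%R D k -> is_invariant k.
Proof.
move=> [Pk sk mk _]; split=> //; first by rewrite /corr_order sk.
exact: even_parity_sum.
Qed.

Lemma invariant_sector D k : is_invariant k -> total_degree k <= D ->
  sector predT (corr_order k) 0%R D k.
Proof. by move=> [_ mk _] kD; split => //; exact: all_predT. Qed.

Lemma cardK_le n D :
  cardK G n.+1 D <= (2 * D.+1) ^ (index_dim G * n.+1).-1.
Proof.
apply: leq_trans (card_sector_le predT n 0%R D).
apply: card_fset_set_sub; first exact: finite_sector.
by move=> k [kI kD <-]; exact: invariant_sector.
Qed.

Lemma cardK_ge n : exists L, forall E,
  E ^ (index_dim G * n.+1).-1 <= cardK G n.+1 (L * E) * n.+1`!.
Proof.
have [L HL] := card_sector_ge G n 0; exists L => E.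
apply: leq_trans (HL E 0%R _) _ => //; rewrite leq_mul2r; apply/orP; right.
apply: card_fset_set_sub; first exact: Kset_finite.
by move=> k kS; case: (kS) => *; split => //; exact: even_sector_invariant kS.
Qed.

Lemma cardD_le n D :
  cardD G n.+2 D <= n.+1 * (2 * D.+1) ^ (index_dim G * n.+2).-2.
Proof.
(* Both orders are at least 1, so they are i + 1 and n - i + 1 with i <= n: this gives n + 1 pieces,
   all with the same exponent d(n + 2) - 2. *)
pose split i k := exists k1 k2, [/\ sector predT i.+1 0%R D k1,
  sector predT (n - i).+1 0%R D k2 & k = k1 `+` k2].
apply: (@card_fset_set_cover _ _ split); first exact: Dset_finite.
  move=> i; rewrite ltnS => le_in.
  apply: (@leq_trans ((2 * D.+1) ^ (index_dim G * i.+1).-1 *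
                      (2 * D.+1) ^ (index_dim G * (n - i).+1).-1)); last first.
    rewrite -expnD; apply/eq_leq; congr (_ ^ _).
    by case: (G) => /=; lia.
  apply: leq_trans (leq_mul (card_sector_le predT i 0%R D)
                            (card_sector_le predT (n - i) 0%R D)).
  apply: (@card_fset_set_image2 _ _ _ (fun k1 k2 => k1 `+` k2)).
  - exact: finite_sector.
  - exact: finite_sector.
  - exact/finite_setIl/Dset_finite.
  - by move=> k [].
move=> k [[_ kD kn] [k1 [k2 [k1I k2I kE]]]].
have kS : corr_order k1 + corr_order k2 = n.+2.
  by rewrite -kn kE /corr_order (perm_size (perm_msetD _ _)) size_cat.
have [k1S _ _] := k1I; have [k2S _ _] := k2I.
move: kD; rewrite kE total_degree_msetD => kD.
exists (corr_order k1).-1; first by lia.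
exists k1, k2; split => //.
  by rewrite prednK//; apply: invariant_sector => //; lia.
have -> : (n - (corr_order k1).-1).+1 = corr_order k2 by lia.
by apply: invariant_sector => //; lia.
Qed.

(** A particle with m = 0 and even l is invariant by itself, and removing it from an invariant
    multiset with all l even leaves an invariant one. The 3 added to [L] is the radius factor of
    [card_slice_ge] at M = 0. *)
Lemma cardD_ge n : exists L, forall E,
  E ^ (index_dim G * n.+2).-2 <= cardD G n.+2 (L * E) * n.+2`!.
Proof.
have [L HL] := card_sector_ge G n 0; exists (L + 3) => E.
have stepE := @card_sector_step G (@even_index G)
  (slice (@even_index G) 0%R (3 * E)) n.+1 0%R (L * E) (3 * E)
  (E ^ (index_dim G * n.+1).-1) n.+1`! (finite_slice _ _ _) _ _.
apply: (@leq_trans (E ^ (index_dim G).-1 * E ^ (index_dim G * n.+1).-1)).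
  by rewrite -expnD; apply/eq_leq; congr (_ ^ _); case: (G) => /=; lia.
apply: leq_trans (leq_mul (@card_slice_ge G 0%R 0 E _) (leqnn _)) _ => //.
apply: leq_trans (stepE _ _) _ => [i [[]]//|i [_ /= ->]|].
  by rewrite subrr; exact: HL.
rewrite -mulnA -factS leq_mul2r -mulnDl; apply/orP; right.
apply: card_fset_set_sub; first exact: Dset_finite.
move=> k [kS [i iA ik]]; have [_ kn _ kD] := kS; split.
  by split => //; exact: even_sector_invariant kS.
exists [mset i], (k `\ i); split; last by rewrite msetB1K.
  by apply: even_sector_invariant; apply/sector_mset1; exact: iA.
have := sector_msetB1 kS ik; case: iA => _ /= ->; rewrite subrr.
exact: even_sector_invariant.
Qed.

Lemma leq_cardK n D D' : D <= D' -> cardK G n D <= cardK G n D'.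
Proof.
move=> DD'; apply: card_fset_set_sub; first exact: Kset_finite.
by move=> k [kI kD kn]; split => //; exact: leq_trans DD'.
Qed.

Lemma leq_cardD n D D' : D <= D' -> cardD G n D <= cardD G n D'.
Proof.
move=> DD'; apply: card_fset_set_sub; first exact: Dset_finite.
by move=> k [[kI kD kn] kdep]; split => //; split => //; exact: leq_trans DD'.
Qed.

(** The lower bounds hold at multiples of a constant; taking E = D %/ L and using monotonicity in
    the degree extends them to every large D. The inequalities avoid division, so they stay in
    [nat]. *)
Lemma cardD_cardK_bounds n : exists C1 C2 L, forall D, L <= D ->
  [/\ 0 < D, 0 < cardK G n.+2 D,
      D * cardD G n.+2 D <= C1 * cardK G n.+2 D &
      cardK G n.+2 D <= C2 * (D * cardD G n.+2 D)].
Proof.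
have [L1 HL1] := cardK_ge n.+1; have [L2 HL2] := cardD_ge n.
(* Only the fact that the factorial is a constant independent of [E] matters from here on. *)
move: n.+2`! HL1 HL2 => F HL1 HL2.
pose L := (L1 + L2).+1; pose q := (index_dim G * n.+2).-2.
have qE : (index_dim G * n.+2).-1 = q.+1 by rewrite /q; case: (G) => /=; lia.
(* With X = 2(D + 1) <= 4LE, the first constant comes from D #D <= (n + 1) X^(q+1) and E^(q+1) <= F
   #K; the second from #K <= X^(q+1), X <= 4D and E^q <= F #D. *)
exists (n.+1 * (4 * L) ^ q.+1 * F), (4 * (4 * L) ^ q * F), L => D LD.
have D_gt0 : 0 < D by exact: leq_trans LD.
pose E := D %/ L; pose X := 2 * D.+1.
have E_gt0 : 0 < E by rewrite divn_gt0.
(* Euclidean division gives D + 1 <= (E + 1)L, and E >= 1 bounds this by 2LE. *)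
have XE : X <= 4 * L * E.
  have := ltn_ceil D (ltn0Sn (L1 + L2)); rewrite -/L -/E /X; nia.
have LED : L * E <= D by rewrite mulnC leq_trunc_div.
have Kge : E ^ q.+1 <= cardK G n.+2 D * F.
  rewrite -qE; apply: leq_trans (HL1 E) _; rewrite leq_mul2r.
  by apply/orP; right; apply: leq_cardK; rewrite /L in LED; nia.
have Dge : E ^ q <= cardD G n.+2 D * F.
  apply: leq_trans (HL2 E) _; rewrite leq_mul2r.
  by apply/orP; right; apply: leq_cardD; rewrite /L in LED; nia.
have Kle := cardK_le n.+1 D; rewrite qE -/X in Kle.
have Dle := cardD_le n D; rewrite -/q -/X in Dle.
have Xexp j : X ^ j <= (4 * L) ^ j * E ^ j.
  by rewrite -expnMn; case: j => // j; rewrite leq_exp2r.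
split => //.
- have : 0 < E ^ q.+1 by rewrite expn_gt0 E_gt0.
  by move=> /leq_trans/(_ Kge); rewrite muln_gt0 => /andP[].
- apply: (@leq_trans (X * (n.+1 * X ^ q))).
    by apply: leq_mul Dle; rewrite /X; lia.
  rewrite mulnCA -expnS -!mulnA leq_pmul2l//; apply: leq_trans (Xexp _) _.
  by rewrite leq_mul2l [F * _]mulnC Kge orbT.
- apply: leq_trans Kle _; rewrite expnS.
  apply: (@leq_trans ((4 * D) * ((4 * L) ^ q * (cardD G n.+2 D * F)))).
    apply: leq_mul; first by rewrite /X; lia.
    apply: leq_trans (Xexp _) _; by rewrite leq_mul2l Dge orbT.
  by apply/eq_leq; lia.
Qed.

End DependentCount.

(** * From inequalities between naturals to the asymptotic statement over the reals *)

Theorem theorem3p1 (R : realType) (nu : nat) (hnu : (3 <= nu)%N)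
    (G : sym_group) :
  (fun D : nat => (cardD G nu D)%:R / (cardK G nu D)%:R : R)
    =Theta_\oo (fun D : nat => 1 / D%:R : R).
Proof.
case: nu hnu => [|[|n]]// _.
have [C1 [C2 [L HL]]] := cardD_cardK_bounds G n.
rewrite eqThetaE qualifE; apply/asboolP.
(* The successors make both constants positive whatever [C1] and [C2] are. *)
exists ((C2.+1%:R)^-1, C1.+1%:R) => /=; first by rewrite invr_gt0 !ltr0n.
(* From [L] on both denominators are nonzero, so neither quotient takes the default value of
   division by zero. *)
exists L => // D /= /HL[D_gt0 K_gt0 ub lb].
rewrite !normf_div !normr1 !normr_nat mul1r.
have D0 : 0 < D%:R :> R by rewrite ltr0n.
have K0 : 0 < (cardK G n.+2 D)%:R :> R by rewrite ltr0n.
split.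
  rewrite -invfM -[X in X <= _]mul1r ler_pdivrMr ?mulr_gt0 ?ltr0n//.
  rewrite mulrAC ler_pdivlMr// mul1r -!natrM ler_nat.
  by apply: leq_trans lb _; nia.
rewrite ler_pdivrMr// mulrAC ler_pdivlMr// -!natrM ler_nat.
by rewrite mulnC; apply: leq_trans ub _; nia.
Qed.
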